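(* Let $\lambda_1,\lambda_2\in\mathbb{D}$, let $(s,p)=(\lambda_1+\lambda_2,\lambda_1\lambda_2)$ (so $(s,p)\in\mathbb{G}$), let $\beta=\dfrac{s-\bar s p}{1-|p|^2}$ (so that $\beta\in\mathbb{D}$ and $s=\beta+\bar\beta p$), and let $a\in\mathbb{C}$. The following statements are equivalent: (1) $(a,s,p)\in\mathcal{P}$; (2) $(a,s,p)\in\mathcal{P}_\mu$; (3) $|a|<\left|1-\dfrac{\tfrac12 s\bar\beta}{1+\sqrt{1-|\beta|^2}}\right|$; (4) $|a|<\tfrac12|1-\bar\lambda_2\lambda_1|+\tfrac12(1-|\lambda_1|^2)^{1/2}(1-|\lambda_2|^2)^{1/2}$; (5) $\sup_{z\in\mathbb{D}}|\Psi_z(a,s,p)|<1$. In particular $\mathcal{P}=\mathcal{P}_\mu$.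
   Context: $\mathbb{D}$ is the open unit disc; $\mathbb{G}=\{(z+w,zw):|z|<1,|w|<1\}$. $\mathbb{B}$ is the open unit ball of $\mathbb{C}^{2\times2}$ in the operator norm. $\pi:\mathbb{C}^{2\times 2}\to\mathbb{C}^3$ is $\pi(A)=(a_{21},\operatorname{tr}A,\det A)$ for $A=[a_{ij}]$, and the pentablock is $\mathcal{P}=\pi(\mathbb{B})$. Let $E=\{\begin{pmatrix}z&w\\0&z\end{pmatrix}: z,w\in\mathbb{C}\}$ and $1/\mu_E(A)=\inf\{\|X\|:X\in E,\ \det(I-AX)=0\}$ ($\mu_E(A)=0$ if no such $X$). $\mathcal{P}_\mu=\{\pi(A): A\in\mathbb{C}^{2\times2},\ \mu_E(A)<1\}$. For $z\in\mathbb{D}$ and $(a,s,p)$ with $1-sz+pz^2\ne0$, $\Psi_z(a,s,p)=\dfrac{a(1-|z|^2)}{1-sz+pz^2}$. *)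

(* Defs.v *)
(* complex numbers are modelled as pairs of Stdlib reals,
   since sups/infs and real square roots are needed. *)
From Stdlib Require Import Reals.
Open Scope R_scope.

Definition Cx : Type := (R * R)%type.
Definition RtoC (r : R) : Cx := (r, 0).
Definition Cx0 : Cx := (0, 0).
Definition Cx1 : Cx := (1, 0).
Definition Cadd (z w : Cx) : Cx := (fst z + fst w, snd z + snd w).
Definition Copp (z : Cx) : Cx := (- fst z, - snd z).
Definition Csub (z w : Cx) : Cx := Cadd z (Copp w).
Definition Cmul (z w : Cx) : Cx :=
  (fst z * fst w - snd z * snd w, fst z * snd w + snd z * fst w).
Definition Cconj (z : Cx) : Cx := (fst z, - snd z).
Definition Cmod (z : Cx) : R := sqrt (fst z ^ 2 + snd z ^ 2).
Definition Cinv (z : Cx) : Cx :=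
  (fst z / (fst z ^ 2 + snd z ^ 2), - snd z / (fst z ^ 2 + snd z ^ 2)).
Definition Cdiv (z w : Cx) : Cx := Cmul z (Cinv w).

Definition in_D (z : Cx) : Prop := Cmod z < 1.

Definition in_G (s p : Cx) : Prop :=
  exists z w, in_D z /\ in_D w /\ s = Cadd z w /\ p = Cmul z w.

Record M2 : Type := mkM2 { e11 : Cx; e12 : Cx; e21 : Cx; e22 : Cx }.

Definition M2id : M2 := mkM2 Cx1 Cx0 Cx0 Cx1.
Definition M2sub (A B : M2) : M2 :=
  mkM2 (Csub (e11 A) (e11 B)) (Csub (e12 A) (e12 B))
       (Csub (e21 A) (e21 B)) (Csub (e22 A) (e22 B)).
Definition M2mul (A B : M2) : M2 :=
  mkM2 (Cadd (Cmul (e11 A) (e11 B)) (Cmul (e12 A) (e21 B)))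
       (Cadd (Cmul (e11 A) (e12 B)) (Cmul (e12 A) (e22 B)))
       (Cadd (Cmul (e21 A) (e11 B)) (Cmul (e22 A) (e21 B)))
       (Cadd (Cmul (e21 A) (e12 B)) (Cmul (e22 A) (e22 B))).
Definition M2det (A : M2) : Cx :=
  Csub (Cmul (e11 A) (e22 A)) (Cmul (e12 A) (e21 A)).
Definition M2tr (A : M2) : Cx := Cadd (e11 A) (e22 A).

Definition M2apply (A : M2) (v : Cx * Cx) : Cx * Cx :=
  (Cadd (Cmul (e11 A) (fst v)) (Cmul (e12 A) (snd v)),
   Cadd (Cmul (e21 A) (fst v)) (Cmul (e22 A) (snd v))).
Definition vnorm (v : Cx * Cx) : R := sqrt (Cmod (fst v) ^ 2 + Cmod (snd v) ^ 2).

Definition opnorm (A : M2) (r : R) : Prop :=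
  is_lub (fun t => exists v, vnorm v <= 1 /\ t = vnorm (M2apply A v)) r.

Definition in_B (A : M2) : Prop := exists r, opnorm A r /\ r < 1.

Definition pi (A : M2) : Cx * Cx * Cx := (e21 A, M2tr A, M2det A).

Definition in_P (x : Cx * Cx * Cx) : Prop := exists A, in_B A /\ pi A = x.

Definition in_E (X : M2) : Prop := e21 X = Cx0 /\ e11 X = e22 X.

Definition is_glb (S : R -> Prop) (m : R) : Prop :=
  (forall x, S x -> m <= x) /\ (forall b, (forall x, S x -> b <= x) -> b <= m).

Definition mu_E_is (A : M2) (m : R) : Prop :=
  let S := fun r => exists X, in_E X /\ M2det (M2sub M2id (M2mul A X)) = Cx0
                               /\ opnorm X r in
  ((forall X, in_E X -> M2det (M2sub M2id (M2mul A X)) <> Cx0) /\ m = 0)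
  \/ (exists i, is_glb S i /\ m = / i).

Definition in_Pmu (x : Cx * Cx * Cx) : Prop :=
  exists A, (exists m, mu_E_is A m /\ m < 1) /\ pi A = x.

Definition Psi (z a s p : Cx) : Cx :=
  Cdiv (Cmul a (RtoC (1 - Cmod z ^ 2)))
       (Cadd (Csub Cx1 (Cmul s z)) (Cmul p (Cmul z z))).

(* Main.v *)
(* Put K = (|1 - conj(l2) l1| + sqrt((1 - |l1|^2) (1 - |l2|^2))) / 2. Every condition says |a| < K.
   A Gram determinant computation for the indefinite form of signature (1,1) gives
   |1 - s z + p z^2| >= K (1 - |z|^2) on the disc, with equality at the conjugate of the
   hyperbolic midpoint of l1 and l2; this settles (5).
   If |a| < K, a contraction with entry a and eigenvalues l1, l2 can be written down, which
   gives (1). If ||A|| <= c and 1 - A X is singular, a kernel vector v = A X v shows that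
   ||X|| >= 1 / c, hence (1) implies (2). If mu_E(A) < 1, then 1 - s z + p z^2 <> a w for
   |w| <= 1 - |z|^2; at the midpoint this is |a| < K, and for w = 0 it puts the roots l1, l2
   of the characteristic polynomial in the disc. *)
Require Import Defs.
From Stdlib Require Import Reals Lra Classical.
From Coquelicot Require Complex Rcomplements.
Open Scope R_scope.

Declare Scope cx_scope.
Delimit Scope cx_scope with Cx.
Bind Scope cx_scope with Cx.
Infix "+" := Cadd : cx_scope.
Infix "-" := Csub : cx_scope.
Infix "*" := Cmul : cx_scope.
Infix "/" := Cdiv : cx_scope.
Notation "- z" := (Copp z) : cx_scope.
Notation "1" := Cx1 : cx_scope.
Notation "0" := Cx0 : cx_scope.

(** * Complex numbers *)

(** [Cx] and its operations are convertible to Coquelicot's complex numbers, so facts proved there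
    transfer by [exact]. *)
Lemma Cx_field : field_theory Cx0 Cx1 Cadd Cmul Csub Copp Cdiv Cinv (@eq Cx).
Proof. exact Complex.C_field_theory. Qed.

Add Field Cx_field_inst : Cx_field.

Ltac cx_coords :=
  unfold Csub, Cadd, Copp, Cmul, Cconj, RtoC, Cx0, Cx1; simpl.

Ltac cx_ring := apply injective_projections; cx_coords; try field.

Lemma Cmod_sqr (z : Cx) : Cmod z ^ 2 = fst z ^ 2 + snd z ^ 2.
Proof. unfold Cmod; apply pow2_sqrt; nra. Qed.

Lemma Cmod_mul (z w : Cx) : Cmod (z * w)%Cx = Cmod z * Cmod w.
Proof. exact (Complex.Cmod_mult z w). Qed.

Lemma Cmod_add_le (z w : Cx) : Cmod (z + w)%Cx <= Cmod z + Cmod w.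
Proof. exact (Complex.Cmod_triangle z w). Qed.

Lemma Cmod_ge0 (z : Cx) : 0 <= Cmod z.
Proof. apply sqrt_pos. Qed.

Lemma Cmod_eq0 (z : Cx) : Cmod z = 0 -> z = Cx0.
Proof. exact (Complex.Cmod_eq_0 z). Qed.

Lemma Cmod_gt0 (z : Cx) : z <> Cx0 -> 0 < Cmod z.
Proof. exact (proj1 (Complex.Cmod_gt_0 z)). Qed.

Lemma Cmod_RtoC (r : R) : Cmod (RtoC r) = Rabs r.
Proof. exact (Complex.Cmod_R r). Qed.

Lemma Cmod_0 : Cmod Cx0 = 0.
Proof. exact Complex.Cmod_0. Qed.

Lemma Cmod_1 : Cmod Cx1 = 1.
Proof. exact Complex.Cmod_1. Qed.

Lemma Cmod_conj (z : Cx) : Cmod (Cconj z) = Cmod z.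
Proof. unfold Cmod; cbn [fst snd Cconj]; f_equal; ring. Qed.

Lemma Cmod_opp (z : Cx) : Cmod (- z)%Cx = Cmod z.
Proof. exact (Complex.Cmod_opp z). Qed.

Lemma Cmod_div (z w : Cx) : w <> Cx0 -> Cmod (z / w)%Cx = Cmod z / Cmod w.
Proof. exact (Complex.Cmod_div z w). Qed.

Lemma Cmod_sub_le (z w : Cx) : Cmod (z - w)%Cx <= Cmod z + Cmod w.
Proof. rewrite <- (Cmod_opp w); apply Cmod_add_le. Qed.

Lemma Cmul_integral (z w : Cx) : (z * w)%Cx = Cx0 -> z = Cx0 \/ w = Cx0.
Proof.
  intros H; apply (f_equal Cmod) in H; rewrite Cmod_mul, Cmod_0 in H.
  destruct (Rmult_integral _ _ H); [left | right]; now apply Cmod_eq0.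
Qed.

Lemma Cmul_conj (z : Cx) : (z * Cconj z)%Cx = RtoC (Cmod z ^ 2).
Proof. rewrite Cmod_sqr; cx_ring. Qed.

(** Half-angle formulas: the parts of the root have moduli [sqrt ((r + u) / 2)] and
    [sqrt ((r - u) / 2)], and the sign of [v] fixes their relative sign. *)
Lemma Cx_sqrt_exists (z : Cx) : exists w, (w * w)%Cx = z.
Proof.
  destruct z as [u v].
  set (r := Cmod (u, v)).
  assert (Hr : r ^ 2 = u ^ 2 + v ^ 2) by (unfold r; rewrite Cmod_sqr; reflexivity).
  assert (Hr0 : 0 <= r) by apply Cmod_ge0.
  assert (H1 : 0 <= (r + u) / 2) by nra.
  assert (H2 : 0 <= (r - u) / 2) by nra.
  pose proof (sqrt_sqrt _ H1) as E1; pose proof (sqrt_sqrt _ H2) as E2.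
  assert (E3 : sqrt ((r + u) / 2) * sqrt ((r - u) / 2) = Rabs (v / 2)).
  { rewrite <- sqrt_mult by assumption.
    replace ((r + u) / 2 * ((r - u) / 2)) with (Rsqr (v / 2)) by (unfold Rsqr; nra).
    apply sqrt_Rsqr_abs. }
  destruct (Rle_dec 0 v) as [Hv | Hv].
  - exists (sqrt ((r + u) / 2), sqrt ((r - u) / 2)).
    rewrite Rabs_right in E3 by lra.
    apply injective_projections; cx_coords; lra.
  - exists (sqrt ((r + u) / 2), - sqrt ((r - u) / 2)).
    rewrite Rabs_left in E3 by lra.
    apply injective_projections; cx_coords; lra.
Qed.

Lemma monic_quadratic_roots (s p : Cx) :
  exists l1 l2, s = (l1 + l2)%Cx /\ p = (l1 * l2)%Cx.
Proof.
  destruct (Cx_sqrt_exists (s * s - RtoC 4 * p)%Cx) as [w Hw].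
  exists (RtoC (1 / 2) * (s + w))%Cx, (RtoC (1 / 2) * (s - w))%Cx; split.
  - cx_ring.
  - transitivity (RtoC (1 / 4) * (s * s - w * w))%Cx; [| cx_ring].
    rewrite Hw; cx_ring.
Qed.

(** * Operator norms of 2x2 matrices *)

Definition M2frob (A : M2) : R :=
  Cmod (e11 A) ^ 2 + Cmod (e12 A) ^ 2 + Cmod (e21 A) ^ 2 + Cmod (e22 A) ^ 2.

Lemma vnorm_ge0 (v : Cx * Cx) : 0 <= vnorm v.
Proof. apply sqrt_pos. Qed.

Lemma vnorm_sqr (v : Cx * Cx) : vnorm v ^ 2 = Cmod (fst v) ^ 2 + Cmod (snd v) ^ 2.
Proof. unfold vnorm; apply pow2_sqrt; nra. Qed.

Lemma vnorm_gt0 (v : Cx * Cx) : v <> (Cx0, Cx0) -> 0 < vnorm v.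
Proof.
  intros Hv; apply sqrt_lt_R0.
  destruct v as [x y]; simpl fst; simpl snd.
  pose proof (Cmod_ge0 x); pose proof (Cmod_ge0 y).
  destruct (Req_dec (Cmod x) 0) as [Ex | Ex]; [| nra].
  destruct (Req_dec (Cmod y) 0) as [Ey | Ey]; [| nra].
  contradict Hv; now rewrite (Cmod_eq0 x), (Cmod_eq0 y).
Qed.

Lemma vnorm_scal (c : R) (v : Cx * Cx) : 0 <= c ->
  vnorm (Cmul (RtoC c) (fst v), Cmul (RtoC c) (snd v)) = c * vnorm v.
Proof.
  intros Hc; unfold vnorm; simpl fst; simpl snd.
  rewrite !Cmod_mul, Cmod_RtoC, Rabs_right by lra.
  rewrite <- (sqrt_pow2 c) at 3 by assumption.
  rewrite <- sqrt_mult by nra; f_equal; ring.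
Qed.

Lemma opnorm_bound (A : M2) (r : R) (v : Cx * Cx) :
  opnorm A r -> vnorm (M2apply A v) <= r * vnorm v.
Proof.
  intros [Hub _].
  destruct (classic (v = (Cx0, Cx0))) as [-> | Hv].
  - assert (E : M2apply A (Cx0, Cx0) = (Cx0, Cx0)).
    { unfold M2apply; simpl fst; simpl snd; f_equal; ring. }
    assert (E0 : vnorm (Cx0, Cx0) = 0).
    { unfold vnorm; simpl fst; simpl snd; rewrite Cmod_0.
      replace (0 ^ 2 + 0 ^ 2) with 0 by ring; apply sqrt_0. }
    rewrite E, E0; lra.
  - pose proof (vnorm_gt0 v Hv) as Hn.
    pose proof (Rinv_0_lt_compat _ Hn) as Hi.
    set (c := / vnorm v) in *.
    set (w := (Cmul (RtoC c) (fst v), Cmul (RtoC c) (snd v))).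
    assert (E : M2apply A w =
      (Cmul (RtoC c) (fst (M2apply A v)), Cmul (RtoC c) (snd (M2apply A v)))).
    { unfold w, M2apply; simpl fst; simpl snd; f_equal; ring. }
    assert (H : vnorm (M2apply A w) <= r).
    { apply Hub; exists w; split; [| reflexivity].
      unfold w; rewrite vnorm_scal by lra.
      unfold c; rewrite Rinv_l; lra. }
    rewrite E, vnorm_scal in H by lra.
    apply (Rmult_le_compat_r (vnorm v)) in H; [| lra].
    replace (c * vnorm (M2apply A v) * vnorm v) with (vnorm (M2apply A v)) in H; [exact H |].
    unfold c; field; lra.
Qed.

Lemma opnorm_exists_le (A : M2) (c : R) : 0 <= c ->
  (forall v, vnorm (M2apply A v) <= c * vnorm v) -> exists r, opnorm A r /\ r <= c.
Proof.
  intros Hc HA.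
  set (T := fun t => exists v, vnorm v <= 1 /\ t = vnorm (M2apply A v)).
  assert (Hub : is_upper_bound T c).
  { intros t [v [Hv ->]]; pose proof (HA v); pose proof (vnorm_ge0 v); nra. }
  destruct (completeness T) as [r Hr].
  - now exists c.
  - exists (vnorm (M2apply A (Cx0, Cx0))), (Cx0, Cx0); split; [| reflexivity].
    unfold vnorm; simpl fst; simpl snd; rewrite Cmod_0.
    replace (0 ^ 2 + 0 ^ 2) with 0 by ring; rewrite sqrt_0; lra.
  - exists r; split; [exact Hr | now apply Hr].
Qed.

(* The hypotheses say that [rho * I - A^* A], whose trace is [2 * rho - M2frob A],
   is positive semidefinite. *)
Lemma contraction_of_frob_det (A : M2) (rho : R) :
  0 <= rho -> M2frob A <= 2 * rho ->
  0 <= rho ^ 2 - rho * M2frob A + Cmod (M2det A) ^ 2 ->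
  forall v, vnorm (M2apply A v) <= sqrt rho * vnorm v.
Proof.
  intros Hrho Htr Hdet [x y].
  apply Rsqr_incr_0_var; [| apply Rmult_le_pos; [apply sqrt_pos | apply vnorm_ge0]].
  rewrite Rsqr_mult, Rsqr_sqrt by assumption.
  rewrite !Rsqr_pow2, !vnorm_sqr.
  destruct A as [[a1 a2] [b1 b2] [c1 c2] [d1 d2]], x as [x1 x2], y as [y1 y2].
  unfold M2frob, M2det, M2apply in *; cbn [e11 e12 e21 e22 fst snd] in *.
  rewrite !Cmod_sqr in *.
  revert Htr Hdet; cx_coords; intros Htr Hdet.
  (* [P] and [Q] are the diagonal entries of [rho * I - A^* A], and [-(g1 + i g2)] is its upper
     right entry, so [HPQ] says that its determinant is nonnegative. *)
  set (P := rho - (a1 ^ 2 + a2 ^ 2 + c1 ^ 2 + c2 ^ 2)).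
  set (Q := rho - (b1 ^ 2 + b2 ^ 2 + d1 ^ 2 + d2 ^ 2)).
  set (g1 := a1 * b1 + a2 * b2 + c1 * d1 + c2 * d2).
  set (g2 := a1 * b2 - a2 * b1 + c1 * d2 - c2 * d1).
  assert (HPQ : g1 ^ 2 + g2 ^ 2 <= P * Q).
  { unfold g1, g2, P, Q; simpl; lra. }
  assert (HS : 0 <= P + Q) by (unfold P, Q; simpl; lra).
  assert (HP : 0 <= P) by nra.
  assert (HQ : 0 <= Q) by nra.
  (* [h1 + i h2 = x conj(y)]. The cross term is bounded by Cauchy-Schwarz, then by the
     arithmetic-geometric mean inequality for [P * X] and [Q * Y]. *)
  set (h1 := x1 * y1 + x2 * y2).
  set (h2 := x2 * y1 - x1 * y2).
  apply Rminus_le.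
  match goal with |- ?L - ?M <= 0 =>
    replace (L - M) with
      (2 * (g1 * h1 - g2 * - h2) - (P * (x1 ^ 2 + x2 ^ 2) + Q * (y1 ^ 2 + y2 ^ 2)))
      by (unfold P, Q, g1, g2, h1, h2; ring) end.
  set (X := x1 ^ 2 + x2 ^ 2); set (Y := y1 ^ 2 + y2 ^ 2).
  assert (HX : 0 <= X) by (unfold X; nra).
  assert (HY : 0 <= Y) by (unfold Y; nra).
  assert (Hh : h1 ^ 2 + h2 ^ 2 = X * Y) by (unfold h1, h2, X, Y; ring).
  assert (Hlag : (g1 * h1 + g2 * h2) ^ 2 <= (P * Q) * (X * Y)).
  { rewrite <- Hh.
    apply Rle_trans with ((g1 ^ 2 + g2 ^ 2) * (h1 ^ 2 + h2 ^ 2)).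
    - pose proof (pow2_ge_0 (g1 * h2 - g2 * h1)); nra.
    - apply Rmult_le_compat_r; [nra | exact HPQ]. }
  assert (HPX : 0 <= P * X) by now apply Rmult_le_pos.
  assert (HQY : 0 <= Q * Y) by now apply Rmult_le_pos.
  assert (2 * (g1 * h1 + g2 * h2) <= P * X + Q * Y); [| lra].
  apply Rsqr_incr_0_var; [| lra].
  rewrite !Rsqr_pow2; pose proof (pow2_ge_0 (P * X - Q * Y)); nra.
Qed.

Lemma in_B_of_frob_det (A : M2) :
  Cmod (M2det A) < 1 -> M2frob A < 1 + Cmod (M2det A) ^ 2 -> in_B A.
Proof.
  intros HD HF.
  pose proof (Cmod_ge0 (M2det A)) as HD0.
  assert (HF0 : 0 <= M2frob A) by (unfold M2frob; nra).
  set (D := Cmod (M2det A) ^ 2) in *.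
  assert (HD1 : 0 <= D < 1) by (unfold D; nra).
  (* With [g = 1 + D - M2frob A > 0] this is [rho = 1 - g / 2], and [rho ^ 2 - rho * M2frob A + D]
     becomes [g / 2 * (rho + D)]. *)
  set (rho := (1 + M2frob A - D) / 2).
  assert (Hrho : 0 <= rho < 1) by (unfold rho; lra).
  destruct (opnorm_exists_le A (sqrt rho)) as [r [Hr Hle]].
  - apply sqrt_pos.
  - apply contraction_of_frob_det; [lra | unfold rho; lra |].
    fold D; unfold rho; nra.
  - exists r; split; [exact Hr |].
    apply Rle_lt_trans with (1 := Hle).
    rewrite <- sqrt_1; apply sqrt_lt_1; lra.
Qed.

Lemma M2_bounded (A : M2) :
  exists c, 0 < c /\ forall v, vnorm (M2apply A v) <= c * vnorm v.
Proof.
  assert (HF0 : 0 <= M2frob A) by (unfold M2frob; nra).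
  exists (sqrt (M2frob A + 1)); split; [apply sqrt_lt_R0; lra |].
  apply contraction_of_frob_det; [lra | lra |].
  pose proof (pow2_ge_0 (Cmod (M2det A))); nra.
Qed.

(** A nonzero row turned by a right angle, [(-b, a)] or [(d, -c)], is killed by that row, and by the
    other one because the determinant or the other row vanishes. *)
Lemma M2_kernel (M : M2) : M2det M = Cx0 ->
  exists v, v <> (Cx0, Cx0) /\ M2apply M v = (Cx0, Cx0).
Proof.
  destruct M as [a b c d]; unfold M2det, M2apply; cbn [e11 e12 e21 e22]; intros Hdet.
  assert (Hneg : forall z, (- z)%Cx = Cx0 -> z = Cx0).
  { intros z Hz; replace z with (- - z)%Cx by ring; rewrite Hz; ring. }
  destruct (classic (a = Cx0 /\ b = Cx0)) as [[Ha Hb] | Hab].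
  - destruct (classic (c = Cx0 /\ d = Cx0)) as [[Hc Hd] | Hcd].
    + exists (Cx1, Cx0); cbn [fst snd]; split.
      * intros H; apply (f_equal (fun v => fst (fst v))) in H; simpl in H; lra.
      * rewrite Ha, Hb, Hc, Hd; f_equal; ring.
    + exists (d, - c)%Cx; cbn [fst snd]; split.
      * intros H; apply Hcd; apply pair_equal_spec in H as [Hd Hc]; auto.
      * rewrite Ha, Hb; f_equal; ring.
  - exists (- b, a)%Cx; cbn [fst snd]; split.
    + intros H; apply Hab; apply pair_equal_spec in H as [Hb Ha]; auto.
    + f_equal; [ring | rewrite <- Hdet; ring].
Qed.

Lemma singular_pencil_norm_ge (A X : M2) (c r : R) :
  (forall v, vnorm (M2apply A v) <= c * vnorm v) -> 0 <= c -> opnorm X r ->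
  M2det (M2sub M2id (M2mul A X)) = Cx0 -> 1 <= c * r.
Proof.
  intros HA Hc HX Hdet.
  destruct (M2_kernel _ Hdet) as [v [Hv Hker]].
  assert (E : v = M2apply A (M2apply X v)).
  { assert (Hsub : M2apply (M2sub M2id (M2mul A X)) v =
      (fst v - fst (M2apply A (M2apply X v)), snd v - snd (M2apply A (M2apply X v)))%Cx).
    { unfold M2apply, M2sub, M2id, M2mul; cbn [e11 e12 e21 e22 fst snd]; f_equal; ring. }
    rewrite Hsub in Hker; apply pair_equal_spec in Hker as [H1 H2].
    pose proof (f_equal fst H1); pose proof (f_equal snd H1).
    pose proof (f_equal fst H2); pose proof (f_equal snd H2).
    unfold Csub, Cadd, Copp, Cx0 in *; cbn [fst snd] in *.
    apply injective_projections; apply injective_projections; lra. }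
  pose proof (vnorm_gt0 v Hv) as Hn.
  pose proof (HA (M2apply X v)) as H1; rewrite <- E in H1.
  pose proof (opnorm_bound X r v HX) as H2.
  nra.
Qed.

(** * The pentablock *)

(* For an element [X] of [E] with entries [z], [w], the value [det (1 - A X)] is
   [1 - s z + p z^2 - a w], and [X] is a contraction iff [|w| <= 1 - |z|^2]. *)
Definition E_nonsingular (a s p : Cx) : Prop :=
  forall z w : Cx, Cmod w <= 1 - Cmod z ^ 2 -> (1 - s * z + p * (z * z))%Cx <> (a * w)%Cx.

Lemma det_pencil_E (A : M2) (z w : Cx) :
  M2det (M2sub M2id (M2mul A (mkM2 z w Cx0 z))) =
  (1 - M2tr A * z + M2det A * (z * z) - e21 A * w)%Cx.
Proof. unfold M2det, M2tr, M2sub, M2id, M2mul; cbn [e11 e12 e21 e22]; ring. Qed.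

(** For [rho = 1] the determinant criterion reads [|w|^2 <= (1 - |z|^2)^2]. *)
Lemma E_contraction (z w : Cx) : Cmod w <= 1 - Cmod z ^ 2 ->
  exists r, opnorm (mkM2 z w Cx0 z) r /\ r <= 1.
Proof.
  intros H; pose proof (Cmod_ge0 w) as Hw; pose proof (Cmod_ge0 z) as Hz.
  apply opnorm_exists_le; [lra |].
  rewrite <- sqrt_1.
  assert (Hdet : M2det (mkM2 z w Cx0 z) = (z * z)%Cx)
    by (unfold M2det; cbn [e11 e12 e21 e22]; ring).
  apply contraction_of_frob_det; [lra | |]; rewrite ?Hdet, ?Cmod_mul; unfold M2frob;
    cbn [e11 e12 e21 e22]; rewrite Cmod_0.
  - nra.
  - assert (Cmod w ^ 2 <= (1 - Cmod z ^ 2) ^ 2) by (apply pow_incr; lra). nra.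
Qed.

(** * From the unit ball to [mu_E], and from [mu_E] to the nonsingular pencil *)

Lemma glb_exists (S : R -> Prop) (b : R) :
  (exists x, S x) -> (forall x, S x -> b <= x) -> exists i, is_glb S i /\ b <= i.
Proof.
  intros [x0 Hx0] Hb.
  destruct (completeness (fun t => S (- t))) as [m [Hub Hlub]].
  - exists (- b); intros t Ht; apply Hb in Ht; lra.
  - exists (- x0); now rewrite Ropp_involutive.
  - exists (- m); split; [split |].
    + intros x Hx.
      assert (- x <= m); [| lra].
      apply Hub; now rewrite Ropp_involutive.
    + intros c Hc.
      assert (m <= - c); [| lra].
      apply Hlub; intros t Ht; apply Hc in Ht; lra.
    + assert (m <= - b); [| lra].
      apply Hlub; intros t Ht; apply Hb in Ht; lra.
Qed.

Lemma in_P_in_Pmu (x : Cx * Cx * Cx) : in_P x -> in_Pmu x.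
Proof.
  intros [A [[r0 [Hr0 Hlt]] Hpi]]; exists A; split; [| exact Hpi].
  (* Halfway to 1, so that [c] stays below 1 and is invertible even if [r0 = 0]. *)
  set (c := (Rmax r0 0 + 1) / 2).
  assert (Hc : 0 < c < 1 /\ r0 <= c).
  { unfold c; pose proof (Rmax_l r0 0); pose proof (Rmax_r r0 0).
    pose proof (Rmax_lub_lt r0 0 1 Hlt Rlt_0_1); lra. }
  assert (HA : forall v, vnorm (M2apply A v) <= c * vnorm v).
  { intros v; pose proof (opnorm_bound A r0 v Hr0); pose proof (vnorm_ge0 v); nra. }
  set (S := fun r => exists X, in_E X /\ M2det (M2sub M2id (M2mul A X)) = Cx0
                               /\ opnorm X r).
  destruct (classic (exists r, S r)) as [HS | HS].
  - destruct (glb_exists S (/ c) HS) as [i [Hi Hci]].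
    { intros r [X [_ [Hdet HX]]].
      pose proof (singular_pencil_norm_ge A X c r HA ltac:(lra) HX Hdet) as H.
      apply Rmult_le_reg_l with c; [lra |]; rewrite Rinv_r; lra. }
    exists (/ i); split; [right; now exists i |].
    assert (1 < / c) by (rewrite <- Rinv_1; apply Rinv_lt_contravar; lra).
    rewrite <- Rinv_1; apply Rinv_lt_contravar; lra.
  (* Every matrix has an operator norm, so an empty [S] means that no [X] in [E] makes the pencil
     singular. *)
  - exists 0; split; [left; split; [| reflexivity] | lra].
    intros X HX Hdet; apply HS.
    destruct (M2_bounded X) as [d [Hd HXd]].
    destruct (opnorm_exists_le X d ltac:(lra) HXd) as [r [Hr _]].
    now exists r, X.
Qed.

Lemma in_Pmu_E_nonsingular (a s p : Cx) : in_Pmu (a, s, p) -> E_nonsingular a s p.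
Proof.
  intros [A [[m [Hm Hlt]] Hpi]] z w Hzw Heq.
  injection Hpi as Ha Hs Hp.
  set (X := mkM2 z w Cx0 z).
  assert (HX : in_E X) by (split; reflexivity).
  assert (Hdet : M2det (M2sub M2id (M2mul A X)) = Cx0).
  { unfold X; rewrite det_pencil_E, Ha, Hs, Hp, Heq; ring. }
  destruct (E_contraction z w Hzw) as [r [Hr Hr1]].
  destruct Hm as [[Hns _] | [i [[Hlow Hglb] ->]]]; [now apply (Hns X) |].
  destruct (M2_bounded A) as [c [Hc HA]].
  assert (Hi1 : i <= 1).
  { apply Rle_trans with r; [| exact Hr1]. apply Hlow; now exists X. }
  (* Since [/ 0 = 0], the bound [i <= 1] yields [1 <= / i] only once [i] is known to be positive;
     the boundedness of [A] provides this. *)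
  assert (Hci : / c <= i).
  { apply Hglb; intros t [Y [_ [HdetY HY]]].
    pose proof (singular_pencil_norm_ge A Y c t HA ltac:(lra) HY HdetY) as H.
    apply Rmult_le_reg_l with c; [lra |]; rewrite Rinv_r; lra. }
  pose proof (Rinv_0_lt_compat c Hc).
  assert (1 <= / i); [| lra].
  rewrite <- Rinv_1; apply Rinv_le_contravar; lra.
Qed.

(** * The factorisation of [1 - s z + p z^2] and its size on the disc *)

Lemma E_nonsingular_root (a l1 l2 : Cx) :
  E_nonsingular a (l1 + l2)%Cx (l1 * l2)%Cx -> in_D l1.
Proof.
  intros H; apply Rnot_le_lt; intros Hl.
  assert (Hl0 : l1 <> Cx0) by (intros ->; rewrite Cmod_0 in Hl; lra).
  (* [1 - s z + p z^2] factors as [(1 - l1 z) (1 - l2 z)], and [|l1| >= 1] makes [z = 1 / l1]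
     admissible with [w = 0]. *)
  apply (H (Cx1 / l1)%Cx Cx0).
  - rewrite Cmod_0, Cmod_div, Cmod_1 by assumption.
    assert (1 / Cmod l1 <= 1) by (apply Rcomplements.Rle_div_l; lra).
    assert (0 <= 1 / Cmod l1) by (apply Rcomplements.Rle_div_r; lra).
    nra.
  - field; exact Hl0.
Qed.

(* With [u = (1, l1)], [v = (1, l2)] and the indefinite form
   [[x, y] = x0 conj(y0) - x1 conj(y1)], this is
   [(|[u, v]| + sqrt ([u, u] [v, v])) / 2]. *)
Definition pentablock_radius (l1 l2 : Cx) : R :=
  1/2 * Cmod (1 - Cconj l2 * l1)%Cx
  + 1/2 * sqrt (1 - Cmod l1 ^ 2) * sqrt (1 - Cmod l2 ^ 2).

Lemma in_D_sqr (l : Cx) : in_D l -> 0 < 1 - Cmod l ^ 2.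
Proof. unfold in_D; pose proof (Cmod_ge0 l); nra. Qed.

Lemma one_sub_neq0 (z : Cx) : in_D z -> (1 - z)%Cx <> Cx0.
Proof.
  intros Hz H.
  assert (E : z = Cx1) by (replace z with (1 - (1 - z))%Cx by ring; rewrite H; ring).
  unfold in_D in Hz; rewrite E, Cmod_1 in Hz; lra.
Qed.

Lemma in_D_mul (z w : Cx) : in_D z -> in_D w -> in_D (z * w)%Cx.
Proof.
  unfold in_D; rewrite Cmod_mul; intros; pose proof (Cmod_ge0 z); pose proof (Cmod_ge0 w); nra.
Qed.

Lemma in_D_conj (z : Cx) : in_D z -> in_D (Cconj z).
Proof. unfold in_D; now rewrite Cmod_conj. Qed.

Lemma radius_gt0 (l1 l2 : Cx) : in_D l1 -> in_D l2 -> 0 < pentablock_radius l1 l2.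
Proof.
  intros H1 H2; unfold pentablock_radius.
  pose proof (sqrt_lt_R0 _ (in_D_sqr _ H1)); pose proof (sqrt_lt_R0 _ (in_D_sqr _ H2)).
  pose proof (Cmod_ge0 (1 - Cconj l2 * l1)%Cx); nra.
Qed.

(* The lower bound comes from expanding the Gram matrix of [u], [v] in the orthogonal
   basis [(1, conj z)], [(z, 1)] and the inequality
   [(A^2 - C^2)(B^2 - D^2) <= (A B - C D)^2]. *)
Lemma radius_le (l1 l2 z : Cx) : in_D l1 -> in_D l2 -> in_D z ->
  pentablock_radius l1 l2 * (1 - Cmod z ^ 2)
    <= Cmod (1 - (l1 + l2) * z + (l1 * l2) * (z * z))%Cx.
Proof.
  intros H1 H2 Hz.
  pose proof (in_D_sqr _ H1) as K1; pose proof (in_D_sqr _ H2) as K2.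
  pose proof (in_D_sqr _ Hz) as KX.
  set (X := 1 - Cmod z ^ 2) in *.
  replace (1 - (l1 + l2) * z + (l1 * l2) * (z * z))%Cx
    with ((1 - l1 * z) * (1 - l2 * z))%Cx by ring.
  rewrite Cmod_mul.
  set (A := Cmod (1 - l1 * z)%Cx); set (B := Cmod (1 - l2 * z)%Cx).
  set (C := Cmod (Cconj z - l1)%Cx); set (D := Cmod (Cconj z - l2)%Cx).
  assert (HA : 0 <= A) by apply Cmod_ge0.
  assert (HB : 0 <= B) by apply Cmod_ge0.
  assert (HC : 0 <= C) by apply Cmod_ge0.
  assert (HD : 0 <= D) by apply Cmod_ge0.
  (* [A], [C] and [B], [D] are the moduli of the products of [u] and of [v] with the two basis
     vectors. [E1] and [E2] expand [[u, u]] and [[v, v]]; [E3] is the triangle inequality in the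
     expansion of [[u, v]]. *)
  assert (E1 : X * (1 - Cmod l1 ^ 2) = A ^ 2 - C ^ 2).
  { unfold X, A, C; rewrite !Cmod_sqr; cx_coords; ring. }
  assert (E2 : X * (1 - Cmod l2 ^ 2) = B ^ 2 - D ^ 2).
  { unfold X, B, D; rewrite !Cmod_sqr; cx_coords; ring. }
  assert (E3 : X * Cmod (1 - Cconj l2 * l1)%Cx <= A * B + C * D).
  { replace (A * B + C * D) with
      (Cmod ((1 - l1 * z) * Cconj (1 - l2 * z))%Cx
       + Cmod ((Cconj z - l1) * Cconj (Cconj z - l2))%Cx)
      by (rewrite !Cmod_mul, !Cmod_conj; reflexivity).
    rewrite <- (Rabs_right X) at 1 by lra.
    rewrite <- Cmod_RtoC, <- Cmod_mul.
    eapply Rle_trans; [right; apply f_equal | apply Cmod_sub_le].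
    unfold X; rewrite Cmod_sqr; cx_ring. }
  assert (HCA : C <= A) by (assert (0 < X * (1 - Cmod l1 ^ 2)) by nra; nra).
  assert (HDB : D <= B) by (assert (0 < X * (1 - Cmod l2 ^ 2)) by nra; nra).
  assert (E4 : X * (sqrt (1 - Cmod l1 ^ 2) * sqrt (1 - Cmod l2 ^ 2)) <= A * B - C * D).
  { apply Rsqr_incr_0_var; [| nra].
    rewrite !Rsqr_mult, !Rsqr_sqrt by lra.
    replace (Rsqr X * ((1 - Cmod l1 ^ 2) * (1 - Cmod l2 ^ 2)))
      with ((A ^ 2 - C ^ 2) * (B ^ 2 - D ^ 2)) by (rewrite <- E1, <- E2; unfold Rsqr; ring).
    unfold Rsqr; pose proof (pow2_ge_0 (A * D - B * C)); nra. }
  (* In the sum of [E3] and [E4] the terms [C * D] cancel. *)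
  unfold pentablock_radius; lra.
Qed.

(* Equality holds at the conjugate of the hyperbolic midpoint of [l1] and [l2]. *)
Lemma radius_attained (l1 l2 : Cx) : in_D l1 -> in_D l2 ->
  exists z, in_D z /\
    Cmod (1 - (l1 + l2) * z + (l1 * l2) * (z * z))%Cx
      = pentablock_radius l1 l2 * (1 - Cmod z ^ 2).
Proof.
  intros H1 H2; unfold pentablock_radius.
  pose proof (in_D_sqr _ H1) as K1; pose proof (in_D_sqr _ H2) as K2.
  set (t1 := sqrt (1 - Cmod l1 ^ 2)); set (t2 := sqrt (1 - Cmod l2 ^ 2)).
  assert (Ht1 : 0 < t1) by now apply sqrt_lt_R0.
  assert (Ht2 : 0 < t2) by now apply sqrt_lt_R0.
  assert (E1 : t1 ^ 2 = 1 - Cmod l1 ^ 2) by (apply pow2_sqrt; lra).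
  assert (E2 : t2 ^ 2 = 1 - Cmod l2 ^ 2) by (apply pow2_sqrt; lra).
  set (eta := (1 - Cconj l2 * l1)%Cx); set (k := Cmod eta).
  assert (Hk : 0 < k).
  { apply Cmod_gt0, one_sub_neq0, in_D_mul; [now apply in_D_conj | exact H1]. }
  assert (E3 : k ^ 2 = fst eta ^ 2 + snd eta ^ 2) by apply Cmod_sqr.
  rewrite Cmod_sqr in E1, E2.
  (* [(y0, y1)] is the conjugate of [k t2 u + t1 eta v], a multiple of the sum of the normalised
     vectors [u / t1] and [v / t2], the latter turned by the phase [eta / k] that makes their
     product positive. [F1], [F2], [F3] are the products of [u], of [v] and of the vector itself
     with this vector. *)
  set (y0 := (RtoC (k * t2) + RtoC t1 * Cconj eta)%Cx).
  set (y1 := (RtoC (k * t2) * Cconj l1 + RtoC t1 * (Cconj eta * Cconj l2))%Cx).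
  assert (F1 : (y0 - l1 * y1)%Cx = RtoC (k * t1 * (t1 * t2 + k))).
  { transitivity (RtoC (k * t2) * RtoC (t1 ^ 2) + RtoC t1 * RtoC (k ^ 2))%Cx; [| cx_ring].
    rewrite E1, E3; unfold y0, y1, eta; cx_ring. }
  assert (F2 : (y0 - l2 * y1)%Cx = (RtoC (t2 * (t1 * t2 + k)) * Cconj eta)%Cx).
  { transitivity (RtoC (k * t2) * Cconj eta + RtoC t1 * Cconj eta * RtoC (t2 ^ 2))%Cx;
      [| cx_ring].
    rewrite E2; unfold y0, y1, eta; cx_ring. }
  assert (F3 : Cmod y0 ^ 2 - Cmod y1 ^ 2 = 2 * k ^ 2 * (t1 * t2) * (t1 * t2 + k)).
  { transitivity (k ^ 2 * t2 ^ 2 * t1 ^ 2 + t1 ^ 2 * k ^ 2 * t2 ^ 2 + 2 * k * t1 * t2 * k ^ 2);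
      [| ring].
    rewrite !Cmod_sqr.
    transitivity (k ^ 2 * t2 ^ 2 * (1 - (fst l1 ^ 2 + snd l1 ^ 2))
      + t1 ^ 2 * (fst eta ^ 2 + snd eta ^ 2) * (1 - (fst l2 ^ 2 + snd l2 ^ 2))
      + 2 * k * t1 * t2 * (fst eta ^ 2 + snd eta ^ 2)).
    - unfold y0, y1, eta; cx_coords; ring.
    - rewrite <- E1, <- E2, <- E3; ring. }
  assert (Hb : 0 < t1 * t2) by nra.
  set (b := t1 * t2) in *.
  assert (F3' : 0 < Cmod y0 ^ 2 - Cmod y1 ^ 2).
  { rewrite F3; repeat apply Rmult_lt_0_compat; nra. }
  assert (Hy0 : 0 < Cmod y0).
  { pose proof (Cmod_ge0 y0); pose proof (Cmod_ge0 y1); nra. }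
  assert (Hy0' : y0 <> Cx0) by (intros H; rewrite H, Cmod_0 in Hy0; lra).
  exists (y1 / y0)%Cx; split.
  - unfold in_D; rewrite Cmod_div by assumption.
    apply Rcomplements.Rlt_div_l; [assumption |]; pose proof (Cmod_ge0 y1); nra.
  - replace (1 - (l1 + l2) * (y1 / y0) + (l1 * l2) * ((y1 / y0) * (y1 / y0)))%Cx
      with ((y0 - l1 * y1) * (y0 - l2 * y1) / (y0 * y0))%Cx by (field; assumption).
    rewrite F1, F2, !Cmod_div by (assumption || intros H; apply Cmul_integral in H; tauto).
    rewrite !Cmod_mul, !Cmod_RtoC, Cmod_conj; fold k.
    rewrite !Rabs_right by (apply Rle_ge, Rlt_le; repeat apply Rmult_lt_0_compat; lra).
    replace (1 - (Cmod y1 / Cmod y0) ^ 2) with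
      ((Cmod y0 ^ 2 - Cmod y1 ^ 2) / (Cmod y0 * Cmod y0)) by (field; lra).
    rewrite F3; unfold b; field; lra.
Qed.

Lemma E_nonsingular_radius (a l1 l2 : Cx) : in_D l1 -> in_D l2 ->
  E_nonsingular a (l1 + l2)%Cx (l1 * l2)%Cx -> Cmod a < pentablock_radius l1 l2.
Proof.
  intros H1 H2 H; apply Rnot_le_lt; intros Hle.
  destruct (radius_attained l1 l2 H1 H2) as [z [Hz E]].
  pose proof (radius_gt0 l1 l2 H1 H2) as HK.
  assert (Ha : a <> Cx0) by (intros ->; rewrite Cmod_0 in Hle; lra).
  pose proof (in_D_sqr z Hz).
  (* If [|a|] is at least the radius, dividing the extremal value by [a] gives an admissible [w]. *)
  apply (H z ((1 - (l1 + l2) * z + (l1 * l2) * (z * z)) / a)%Cx).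
  - rewrite Cmod_div, E by assumption.
    apply Rcomplements.Rle_div_l; [now apply Cmod_gt0 | nra].
  - field; exact Ha.
Qed.

(** * Contractions with prescribed corner entry and eigenvalues *)

(** Splitting off the scalar matrix [h], half the trace, leaves a traceless matrix with determinant
    [-d^2]. The inequality is the Frobenius criterion, since [2 |h|^2 + 2 |d|^2 = |l1|^2 + |l2|^2]
    and [1 + |l1 l2|^2 - |l1|^2 - |l2|^2 = (1 - |l1|^2) (1 - |l2|^2)]. *)
Lemma in_P_of_completion (l1 l2 a e x : Cx) : in_D l1 -> in_D l2 ->
  let d := (RtoC (1/2) * (l1 - l2))%Cx in
  (e * e + a * x)%Cx = (d * d)%Cx ->
  2 * Cmod e ^ 2 + Cmod x ^ 2 + Cmod a ^ 2
    < 2 * Cmod d ^ 2 + (1 - Cmod l1 ^ 2) * (1 - Cmod l2 ^ 2) ->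
  in_P (a, l1 + l2, l1 * l2)%Cx.
Proof.
  intros H1 H2 d Hd Hlt.
  set (h := (RtoC (1/2) * (l1 + l2))%Cx).
  set (A := mkM2 (h + e)%Cx x a (h - e)%Cx).
  assert (Hdet : M2det A = (l1 * l2)%Cx).
  { unfold M2det, A; cbn [e11 e12 e21 e22].
    transitivity (h * h - (e * e + a * x))%Cx; [ring |].
    rewrite Hd; unfold h, d; cx_ring. }
  exists A; split.
  - apply in_B_of_frob_det; rewrite Hdet; [now apply in_D_mul |].
    unfold M2frob, A; cbn [e11 e12 e21 e22].
    assert (Ehe : Cmod (h + e)%Cx ^ 2 + Cmod (h - e)%Cx ^ 2
                  = 2 * Cmod h ^ 2 + 2 * Cmod e ^ 2).
    { rewrite !Cmod_sqr; cx_coords; ring. }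
    assert (Ehd : 2 * Cmod h ^ 2 + 2 * Cmod d ^ 2 = Cmod l1 ^ 2 + Cmod l2 ^ 2).
    { rewrite !Cmod_sqr; unfold h, d; cx_coords; field. }
    rewrite Cmod_mul; nra.
  - unfold pi, M2tr; rewrite Hdet; unfold A; cbn [e11 e12 e21 e22].
    f_equal; f_equal; unfold h; cx_ring.
Qed.

(* When [|a| < |d|], [d = (l1 - l2)/2], a normal matrix works; otherwise the one with
   equal diagonal entries, whose norm is extremal. *)
Lemma radius_in_P (l1 l2 a : Cx) : in_D l1 -> in_D l2 ->
  Cmod a < pentablock_radius l1 l2 -> in_P (a, l1 + l2, l1 * l2)%Cx.
Proof.
  intros H1 H2 Ha.
  pose proof (in_D_sqr _ H1) as K1; pose proof (in_D_sqr _ H2) as K2.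
  set (d := (RtoC (1/2) * (l1 - l2))%Cx).
  pose proof (Cmod_ge0 a) as Ha0; pose proof (Cmod_ge0 d) as Hd0.
  assert (HN : 0 < (1 - Cmod l1 ^ 2) * (1 - Cmod l2 ^ 2)) by nra.
  destruct (Rlt_le_dec (Cmod a) (Cmod d)) as [Had | Hda].
  - assert (HD : 0 < Cmod d ^ 2) by nra.
    assert (Hc : 0 <= 1 - Cmod a ^ 2 / Cmod d ^ 2).
    { assert (Cmod a ^ 2 / Cmod d ^ 2 <= 1); [| lra].
      apply Rcomplements.Rle_div_l; nra. }
    set (c := sqrt (1 - Cmod a ^ 2 / Cmod d ^ 2)).
    assert (Ec : c ^ 2 = 1 - Cmod a ^ 2 / Cmod d ^ 2) by now apply pow2_sqrt.
    (* Here [|e|^2 = |d|^2 - |a|^2] and [|x| = |a|], so the left side is exactly [2 |d|^2]. *)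
    apply in_P_of_completion with (e := (RtoC c * d)%Cx)
      (x := (Cconj a * (RtoC (/ Cmod d ^ 2) * (d * d)))%Cx); try assumption; fold d.
    + transitivity (RtoC (c ^ 2) * (d * d)
        + a * Cconj a * (RtoC (/ Cmod d ^ 2) * (d * d)))%Cx; [cx_ring; lra |].
      rewrite Ec, Cmul_conj; cx_ring; lra.
    + rewrite !Cmod_mul, !Cmod_RtoC, Cmod_conj, Rpow_mult_distr, pow2_abs, Ec,
         Rabs_right by (apply Rle_ge, Rlt_le, Rinv_0_lt_compat; exact HD).
      match goal with |- ?L < _ => replace L with (2 * Cmod d ^ 2) by (field; lra) end.
      lra.
  - destruct (Req_dec (Cmod a) 0) as [Ea | Ea].
    + assert (Ed : Cmod d = 0) by lra.
      apply in_P_of_completion with (e := Cx0) (x := Cx0); try assumption; fold d.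
      * rewrite (Cmod_eq0 d Ed); ring.
      * rewrite Cmod_0, Ea, Ed; lra.
    + assert (Ha' : a <> Cx0) by (intros H; apply Ea; rewrite H; exact Cmod_0).
      apply in_P_of_completion with (e := Cx0) (x := (d * d / a)%Cx); try assumption; fold d.
      * field; exact Ha'.
      * rewrite Cmod_0, Cmod_div, Cmod_mul by assumption.
        unfold pentablock_radius in Ha; rewrite Rmult_assoc, <- sqrt_mult in Ha by lra.
        set (N := (1 - Cmod l1 ^ 2) * (1 - Cmod l2 ^ 2)) in *.
        assert (Ek : Cmod (1 - Cconj l2 * l1)%Cx ^ 2 = 4 * Cmod d ^ 2 + N).
        { unfold N, d; rewrite !Cmod_sqr; cx_coords; field. }
        set (k := Cmod (1 - Cconj l2 * l1)%Cx) in *.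
        assert (Hk : 0 <= k) by apply Cmod_ge0.
        pose proof (sqrt_lt_R0 _ HN) as Hb.
        pose proof (pow2_sqrt N ltac:(lra)) as Eb.
        set (b := sqrt N) in *.
        set (t := Cmod a) in *; set (D := Cmod d) in *.
        assert (Hkb : b <= k) by nra.
        (* The goal amounts to [(t - D^2 / t)^2 < b^2]. The difference increases with [t] and equals
           [b] at [t = (k + b) / 2], because [D^2 = (k - b) (k + b) / 4]. *)
        assert (Hroot : t - D * D / t < b).
        { apply Rmult_lt_reg_r with t; [lra |].
          replace ((t - D * D / t) * t) with (t * t - D * D) by (field; lra).
          nra. }
        assert (Hpos : 0 <= t - D * D / t).
        { assert (D * D / t <= t); [| lra].
          apply Rcomplements.Rle_div_l; nra. }
        replace (2 * 0 ^ 2 + (D * D / t) ^ 2 + t ^ 2)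
          with (2 * D ^ 2 + (t - D * D / t) ^ 2) by (field; lra).
        nra.
Qed.

(** * The supremum of [Psi] and the formula in [beta] *)

(** By [radius_le] and [radius_attained] the supremum is [|a| / K], and it is attained in the
    disc. *)
Lemma sup_Psi_radius (l1 l2 a : Cx) : in_D l1 -> in_D l2 ->
  (exists M, is_lub (fun t => exists z, in_D z
      /\ t = Cmod (Psi z a (l1 + l2)%Cx (l1 * l2)%Cx)) M /\ M < 1)
  <-> Cmod a < pentablock_radius l1 l2.
Proof.
  intros H1 H2.
  pose proof (radius_gt0 l1 l2 H1 H2) as HK.
  set (K := pentablock_radius l1 l2) in *.
  assert (HPsi : forall z, in_D z ->
    0 < Cmod (1 - (l1 + l2) * z + (l1 * l2) * (z * z))%Cx /\
    Cmod (Psi z a (l1 + l2)%Cx (l1 * l2)%Cx) = Cmod a * (1 - Cmod z ^ 2)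
      / Cmod (1 - (l1 + l2) * z + (l1 * l2) * (z * z))%Cx).
  { intros z Hz; pose proof (in_D_sqr z Hz).
    assert (Hpos : 0 < Cmod (1 - (l1 + l2) * z + (l1 * l2) * (z * z))%Cx).
    { apply Rlt_le_trans with (2 := radius_le l1 l2 z H1 H2 Hz); fold K; nra. }
    split; [exact Hpos |].
    unfold Psi; rewrite Cmod_div, Cmod_mul, Cmod_RtoC, Rabs_right by
      (lra || intros E; rewrite E, Cmod_0 in Hpos; lra).
    reflexivity. }
  split.
  - intros [M [[Hub _] HM]].
    destruct (radius_attained l1 l2 H1 H2) as [z [Hz E]]; fold K in E.
    pose proof (in_D_sqr z Hz).
    destruct (HPsi z Hz) as [_ HP]; rewrite E in HP.
    assert (HaM : Cmod a / K <= M).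
    { apply Hub; exists z; split; [exact Hz |]; rewrite HP; field; lra. }
    apply Rcomplements.Rle_div_l in HaM; nra.
  - intros Ha.
    set (T := fun t => exists z, in_D z /\ t = Cmod (Psi z a (l1 + l2)%Cx (l1 * l2)%Cx)).
    assert (Hub : is_upper_bound T (Cmod a / K)).
    { intros t [z [Hz ->]].
      pose proof (in_D_sqr z Hz); pose proof (Cmod_ge0 a).
      destruct (HPsi z Hz) as [Hpos ->].
      pose proof (radius_le l1 l2 z H1 H2 Hz) as Hle; fold K in Hle.
      apply Rcomplements.Rle_div_l; [exact Hpos |].
      apply Rmult_le_reg_r with K; [exact HK |].
      replace (Cmod a / K * Cmod (1 - (l1 + l2) * z + (l1 * l2) * (z * z))%Cx * K)
        with (Cmod a * Cmod (1 - (l1 + l2) * z + (l1 * l2) * (z * z))%Cx) by (field; lra).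
      nra. }
    destruct (completeness T) as [M HM].
    + now exists (Cmod a / K).
    + assert (in_D Cx0) by (unfold in_D; rewrite Cmod_0; lra).
      eexists; exists Cx0; split; [assumption | reflexivity].
    + exists M; split; [exact HM |].
      apply Rle_lt_trans with (Cmod a / K); [now apply HM |].
      apply Rcomplements.Rlt_div_l; lra.
Qed.

(* Put [n_i = 1 - |l_i|^2], [b = sqrt (n1 n2)], [eta = 1 - conj(l2) l1], [k = |eta|] and
   [Q = 1 - |p|^2]. Then [sqrt (1 - |beta|^2) = b k / Q], and the quantity on the left is
   [|2 b k + n2 conj(eta) + n1 eta| / (2 (Q + b k))]. *)
Lemma radius_beta (l1 l2 : Cx) : in_D l1 -> in_D l2 ->
  let s := (l1 + l2)%Cx in
  let p := (l1 * l2)%Cx in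
  let beta := ((s - Cconj s * p) / RtoC (1 - Cmod p ^ 2))%Cx in
  Cmod (1 - RtoC (1/2) * (s * Cconj beta) / RtoC (1 + sqrt (1 - Cmod beta ^ 2)))%Cx
  = pentablock_radius l1 l2.
Proof.
  intros H1 H2 s p beta; unfold pentablock_radius.
  pose proof (in_D_sqr _ H1) as K1; pose proof (in_D_sqr _ H2) as K2.
  pose proof (in_D_sqr _ (in_D_mul _ _ H1 H2)) as KQ; fold p in KQ.
  rewrite Rmult_assoc, <- sqrt_mult by lra.
  set (n1 := 1 - Cmod l1 ^ 2) in *; set (n2 := 1 - Cmod l2 ^ 2) in *.
  set (Q := 1 - Cmod p ^ 2) in *.
  set (eta := (1 - Cconj l2 * l1)%Cx); set (k := Cmod eta).
  assert (Hk : 0 <= k) by apply Cmod_ge0.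
  assert (HN : 0 < n1 * n2) by nra.
  pose proof (sqrt_lt_R0 _ HN) as Hb.
  pose proof (pow2_sqrt (n1 * n2) ltac:(lra)) as Eb.
  set (b := sqrt (n1 * n2)) in *.
  assert (En1 : n1 = 1 - (fst l1 ^ 2 + snd l1 ^ 2)) by (unfold n1; now rewrite Cmod_sqr).
  assert (En2 : n2 = 1 - (fst l2 ^ 2 + snd l2 ^ 2)) by (unfold n2; now rewrite Cmod_sqr).
  assert (EQ : Q = n1 + n2 - n1 * n2).
  { unfold Q, p, n1, n2; rewrite Cmod_mul; ring. }
  assert (Ek : k ^ 2 = fst eta ^ 2 + snd eta ^ 2) by apply Cmod_sqr.
  assert (Ex : 2 * fst eta = Q + k ^ 2).
  { rewrite EQ, Ek, En1, En2; unfold eta; cx_coords; ring. }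
  assert (Ebeta : beta = (RtoC (/ Q) * (RtoC n2 * l1 + RtoC n1 * l2))%Cx).
  { transitivity (RtoC (/ Q) * (s - Cconj s * p))%Cx.
    - unfold beta; replace (RtoC (/ Q)) with (Cx1 / RtoC Q)%Cx.
      + field; intros E; apply (f_equal fst) in E; simpl in E; lra.
      + unfold Cdiv, Cinv; cx_ring; nra.
    - f_equal; unfold s, p; rewrite En1, En2; cx_ring. }
  assert (Egamma : 1 - Cmod beta ^ 2 = Rsqr (b * k / Q)).
  { rewrite Ebeta, Cmod_mul, Cmod_RtoC, Rpow_mult_distr, pow2_abs.
    unfold Rsqr; replace (b * k / Q * (b * k / Q)) with (b ^ 2 * k ^ 2 / Q ^ 2) by (field; lra).
    rewrite Eb.
    assert (EW : Q ^ 2 - Cmod (RtoC n2 * l1 + RtoC n1 * l2)%Cx ^ 2 = n1 * n2 * k ^ 2).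
    { rewrite Ek, Cmod_sqr, EQ, En1, En2; unfold eta; cx_coords; ring. }
    rewrite <- EW; field; lra. }
  assert (Hbk : 0 <= b * k) by nra.
  rewrite Egamma, sqrt_Rsqr
    by (apply Rmult_le_pos; [lra | apply Rlt_le, Rinv_0_lt_compat; lra]).
  set (num := (RtoC (2 * (b * k)) + (RtoC n2 * Cconj eta + RtoC n1 * eta))%Cx).
  assert (Hden : 0 < 1 + b * k / Q).
  { assert (0 <= b * k / Q); [| lra].
    apply Rcomplements.Rle_div_r; lra. }
  assert (Enum : (1 - RtoC (1/2) * (s * Cconj beta) / RtoC (1 + b * k / Q))%Cx
                 = (num / RtoC (2 * (Q + b * k)))%Cx).
  { assert (Es : (s * Cconj (RtoC n2 * l1 + RtoC n1 * l2))%Cx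
                 = (RtoC (2 * Q) - (RtoC n2 * Cconj eta + RtoC n1 * eta))%Cx).
    { unfold s, eta; rewrite EQ, En1, En2; cx_ring. }
    assert (Es' : (s * Cconj beta)%Cx
      = (RtoC (/ Q) * (RtoC (2 * Q) - (RtoC n2 * Cconj eta + RtoC n1 * eta)))%Cx).
    { rewrite <- Es, Ebeta; cx_ring; lra. }
    rewrite Es'; unfold num.
    set (V := (RtoC n2 * Cconj eta + RtoC n1 * eta)%Cx).
    assert (Hdiv : forall u r, r <> 0 -> (u / RtoC r)%Cx = (fst u / r, snd u / r)).
    { intros u r Hr; unfold Cdiv, Cinv; cx_ring; assumption. }
    rewrite !Hdiv by lra; cx_ring; split; lra. }
  rewrite Enum.
  rewrite Cmod_div by (intros E; apply (f_equal fst) in E; simpl in E; lra).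
  rewrite Cmod_RtoC, Rabs_right by lra.
  assert (Hnum : Cmod num = (k + b) * (Q + b * k)).
  { apply Rsqr_inj; [apply Cmod_ge0 | nra |].
    rewrite !Rsqr_pow2, Cmod_sqr.
    (* Replacing [(Im eta)^2] by [k^2 - (Re eta)^2] and [(n1 - n2)^2] by [(n1 + n2)^2 - 4 b^2] turns
       [|num|^2] into a perfect square, whose root factors by [2 Re eta = Q + k^2] and
       [n1 + n2 = Q + b^2]. *)
    transitivity ((2 * b * fst eta + k * (n1 + n2)) ^ 2).
    - transitivity (4 * b ^ 2 * k ^ 2 + 4 * b * k * (n1 + n2) * fst eta
        + (n1 + n2) ^ 2 * fst eta ^ 2 + (n1 - n2) ^ 2 * (k ^ 2 - fst eta ^ 2)).
      + replace (k ^ 2 - fst eta ^ 2) with (snd eta ^ 2) by lra.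
        unfold num; cx_coords; ring.
      + replace ((n1 - n2) ^ 2) with ((n1 + n2) ^ 2 - 4 * b ^ 2) by (rewrite Eb; ring).
        ring.
    - f_equal; replace (2 * b * fst eta) with (b * (2 * fst eta)) by ring.
      rewrite Ex; replace (n1 + n2) with (Q + b ^ 2) by (rewrite Eb, EQ; ring); ring. }
  rewrite Hnum; field; lra.
Qed.

Theorem theorem5p2 :
  (forall l1 l2 a : Cx, in_D l1 -> in_D l2 ->
    let s := Cadd l1 l2 in
    let p := Cmul l1 l2 in
    let beta := Cdiv (Csub s (Cmul (Cconj s) p)) (RtoC (1 - Cmod p ^ 2)) in
    let S1 := in_P (a, s, p) in
    let S2 := in_Pmu (a, s, p) in
    let S3 := Cmod a < Cmod (Csub Cx1
                 (Cdiv (Cmul (RtoC (1/2)) (Cmul s (Cconj beta)))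
                       (RtoC (1 + sqrt (1 - Cmod beta ^ 2))))) in
    let S4 := Cmod a < 1/2 * Cmod (Csub Cx1 (Cmul (Cconj l2) l1))
                       + 1/2 * sqrt (1 - Cmod l1 ^ 2) * sqrt (1 - Cmod l2 ^ 2) in
    let S5 := exists M, is_lub (fun t => exists z, in_D z /\ t = Cmod (Psi z a s p)) M
                        /\ M < 1 in
    (S1 <-> S2) /\ (S1 <-> S3) /\ (S1 <-> S4) /\ (S1 <-> S5))
  /\ (forall x : Cx * Cx * Cx, in_P x <-> in_Pmu x).
Proof.
  assert (P_of_Pmu : forall l1 l2 a, in_D l1 -> in_D l2 ->
    in_Pmu (a, l1 + l2, l1 * l2)%Cx -> in_P (a, l1 + l2, l1 * l2)%Cx).
  { intros l1 l2 a H1 H2 H; apply radius_in_P; try assumption.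
    now apply E_nonsingular_radius, in_Pmu_E_nonsingular. }
  split.
  - intros l1 l2 a H1 H2 s p beta S1 S2 S3 S4 S5.
    assert (E12 : S1 <-> S2) by (split; [apply in_P_in_Pmu | now apply P_of_Pmu]).
    assert (E14 : S1 <-> S4).
    { split; [intros H | now apply radius_in_P].
      now apply (E_nonsingular_radius a), in_Pmu_E_nonsingular, in_P_in_Pmu. }
    split; [exact E12 | split; [| split; [exact E14 |]]].
    + unfold S3, beta, s, p; rewrite (radius_beta l1 l2 H1 H2); exact E14.
    + unfold S5, s, p; rewrite (sup_Psi_radius l1 l2 a H1 H2); exact E14.
  - intros [[a s] p]; split; [apply in_P_in_Pmu | intros H].
    (* Here [s] and [p] are arbitrary; membership in [in_Pmu] itself forces [l1] and [l2] into the
       disc. *)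
    destruct (monic_quadratic_roots s p) as [l1 [l2 [-> ->]]].
    pose proof (in_Pmu_E_nonsingular _ _ _ H) as HN.
    apply P_of_Pmu; [now apply (E_nonsingular_root a l1 l2) | | exact H].
    apply (E_nonsingular_root a l2 l1).
    now replace (l2 + l1)%Cx with (l1 + l2)%Cx by ring;
      replace (l2 * l1)%Cx with (l1 * l2)%Cx by ring.
Qed.
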